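(* For any sequence of real numbers $1>r_1>r_2>\cdots$ decreasing to $0$, there is a probability distribution $P$ on $S=\mathbb{N}$ such that $\mathbb{E}[U_t]>r_t$ for all integers $t\ge 1$.
   Context: For a probability distribution $P$ on $\mathbb{N}=\{1,2,\ldots\}$ with $p_i=P(\{i\})$, let $X_1,\ldots,X_t$ be drawn independently according to $P$. The missing mass is the random variable $U_t=P(\mathbb{N}\setminus\{X_1,\ldots,X_t\})$; its expectation is $\mathbb{E}[U_t]=\sum_{i\in\mathbb{N}}p_i(1-p_i)^t$. *)

(* Defs.v *)
From mathcomp Require Export all_boot all_order all_algebra.
From mathcomp Require Export all_classical all_reals all_analysis.
Set Implicit Arguments.
Unset Strict Implicit.
Unset Printing Implicit Defensive.
Export Order.TTheory GRing.Theory Num.Theory.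
Export numFieldNormedType.Exports.

Local Open Scope classical_set_scope.
Local Open Scope ring_scope.

Definition posnat : set nat := [set n | (0 < n)%N].

(* [P] is a probability on [nat], taken with its discrete sigma-algebra; it is
   a distribution on {1, 2, ...} when it gives no mass to 0. *)
Definition on_posnat (R : realType) (P : probability nat R) : Prop :=
  P posnat = 1%E.

Section iid.
Context d (Omega : measurableType d) d' (T : measurableType d') (R : realType).
Variables (Q : probability Omega R) (I : finType) (X : I -> {RV Q >-> T}).

Definition independent_RVs : Prop :=
  forall (J : {set I}) (A : I -> set T), (forall i, measurable (A i)) ->
    Q [set w | forall i, i \in J -> A i (X i w)] =
    (\prod_(i in J) Q (X i @^-1` A i))%E.

Definition iid (P : probability T R) : Prop :=
  independent_RVs /\
  forall i (A : set T), measurable A -> distribution Q (X i) A = P A.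

End iid.

(* U_t = P(N \ {X_1, ..., X_t}); the draws X_1, ..., X_t are indexed by ['I_t],
   that is by 0, ..., t - 1. *)
Definition missing_mass (R : realType) (P : probability nat R)
    d (Omega : measurableType d) (Q : probability Omega R) (t : nat)
    (X : 'I_t -> {RV Q >-> nat}) : Omega -> R :=
  fun w => fine (P (posnat `\` [set X i w | i in [set: 'I_t]])).

(* Main.v *)
(** The bound on U_t holds for every outcome, not only on average: t draws
    remove at most t/n of the uniform distribution on {1, ..., n}.
    Fix a < 1 with r_1 < a and let P be the mixture, with geometric weights
    (1 - a) a^k, of the uniform distributions on {1, ..., n_k}, where n_k is so
    large that t <= (1 - a) n_k whenever a^(k+2) <= r_t. If k is the least index
    with a^(k+2) <= r_t, the components of index at least k each keep a
    proportion at least a of their mass, so U_t >= a^(k+1) > r_t. *)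
From HB Require Import structures.
Require Import Defs.
From mathcomp Require Import ring.

Local Open Scope classical_set_scope.
Local Open Scope ring_scope.

(** The whole series sums to 1 and its first [k] terms telescope to [1 - a ^+ k]; the tail is the
    difference. *)
Lemma nneseries_geometric_tail (R : realType) (a : R) (k : nat) :
  0 < a -> a < 1 ->
  (\sum_(k <= j <oo) ((1 - a) * a ^+ j)%:E = (a ^+ k)%:E)%E.
Proof.
move=> a0 a1; have a1' : `|a| < 1 by rewrite gtr0_norm.
have ge0 j : (0 <= ((1 - a) * a ^+ j)%:E)%E.
  by rewrite lee_fin mulr_ge0 ?subr_ge0 ?exprn_ge0 ?ltW.
have tot : (\sum_(0 <= j <oo) ((1 - a) * a ^+ j)%:E = 1)%E.
  apply/cvg_lim => //; rewrite (_ : (fun n => _) =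
      EFin \o series (geometric (1 - a) a)); last first.
    by apply/funext => n; rewrite /= /series/= sumEFin.
  apply: cvg_EFin; first exact: nearW.
  have := cvg_geometric_series (a := 1 - a) a1'.
  by rewrite divff // subr_eq0 gt_eqF.
have part : \sum_(0 <= j < k) (1 - a) * a ^+ j = 1 - a ^+ k.
  elim: k => [|k IHk]; first by rewrite big_geq// expr0 subrr.
  by rewrite big_nat_recr//= IHk exprS; ring.
move: tot; rewrite (nneseries_split 0 k)// add0n sumEFin part.
move=> /(congr1 (fun x => x - (1 - a ^+ k)%:E)%E).
by rewrite addeAC subee// add0e => ->; rewrite -EFinB; congr EFin; ring.
Qed.

Section uniform_mixture.
Variables (R : realType) (c : nat -> {nonneg R}) (n : nat -> nat).

Definition initial_counting (m : nat) : {measure set nat -> \bar R} :=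
  msum (fun i => \d_(i.+1) : {measure set nat -> \bar R}) m.

(** The factor that normalises counting on {1, ..., [n k]} to a uniform distribution is left to
    [c k], so the total mass is the sum of the [c k * n k]. *)
Definition uniform_mixture : {measure set nat -> \bar R} :=
  mseries (fun k => mscale (c k) (initial_counting (n k))) 0.

Lemma initial_countingE (m : nat) (A : set nat) :
  initial_counting m A = (\sum_(i < m) (i.+1 \in A)%:R)%:E.
Proof. by rewrite -sumEFin; apply: eq_bigr => i _; exact: diracE. Qed.

Lemma initial_counting_full (m : nat) (A : set nat) :
  posnat `<=` A -> initial_counting m A = m%:R%:E.
Proof.
move=> posA; rewrite initial_countingE.
rewrite (eq_bigr (fun=> 1)) ?sumr_const ?card_ord// => i _.
by rewrite mem_set//; exact: posA.
Qed.

(** Double counting in the 0-1 matrix of [x j == i.+1]: a point survives unless some draw hits it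
    ([row]), and each draw hits at most one point ([col]). *)
Lemma initial_counting_posnatD (m t : nat) (x : 'I_t -> nat) :
  ((m%:R - t%:R)%:E <=
   initial_counting m (posnat `\` [set x i | i in [set: 'I_t]]))%E.
Proof.
rewrite initial_countingE lee_fin.
have col (j : 'I_t) : \sum_(i < m) (x j == i.+1)%:R <= 1 :> R.
  have [[i0 /eqP xj]|no] := pselect (exists i : 'I_m, x j == i.+1).
    rewrite (bigD1 i0)//= big1 ?addr0 ?lern1 ?leq_b1// => i.
    by rewrite xj eqSS -(inj_eq val_inj) eq_sym => /negbTE ->.
  by rewrite big1// => i _; case: eqP => // /eqP h; case: no; exists i.
have row (i : 'I_m) : 1 - \sum_(j < t) (x j == i.+1)%:R <=
    (i.+1 \in posnat `\` [set x j | j in [set: 'I_t]])%:R :> R.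
  case: (boolP (_ \in _)) => [_|].
    by rewrite lerBlDr lerDl sumr_ge0.
  rewrite notin_setE => /not_andP[/(_ isT)[]|/contrapT[j _ xj]].
  by rewrite (bigD1 j)//= xj eqxx opprD addrA subrr sub0r oppr_le0 sumr_ge0.
apply: le_trans (ler_sum _ (fun i _ => row i)).
rewrite big_split/= sumr_const card_ord sumrN lerD2l lerN2 exchange_big/=.
rewrite -[leRHS](_ : \sum_(j < t) 1 = _); last by rewrite sumr_const card_ord.
exact: ler_sum.
Qed.

End uniform_mixture.

(** The integral of a nonnegative function is a supremum over the simple functions below it, and the
    constant [c] is one of them. Measurability of the missing mass thus never has to be proved. *)
Lemma integral_ge_cst d (T : measurableType d) (R : realType)
    (Q : probability T R) (f : T -> R) (c : R) :
  0 <= c -> (forall x, c <= f x) -> (c%:E <= \int[Q]_x (f x)%:E)%E.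
Proof.
move=> c0 cf; rewrite ge0_integralTE => [|x]; last by rewrite lee_fin (le_trans c0).
apply: ereal_sup_ubound => /=.
exists (cst_nnsfun T (NngNum c0)) => [x|]; first by rewrite lee_fin.
by rewrite -integralT_nnsfun/= integral_cst//= probability_setT mule1.
Qed.

(** After a nonpositive term the next one is negative, and all later terms stay below it, away from
    the limit 0. *)
Lemma decreasing_cvg0_gt0 (R : realType) (r : nat -> R) :
  (forall t, (1 <= t)%N -> r t.+1 < r t) -> r @ \oo --> (0 : R) ->
  forall t, (1 <= t)%N -> 0 < r t.
Proof.
move=> r_decr r0 t t1; rewrite ltNge; apply/negP => rt.
have rt1 : r t.+1 < 0 := lt_le_trans (r_decr t t1) rt.
have [N _ /(_ (t.+1 + N)%N (leq_addl _ _))] := cvgr_gt _ r0 _ rt1.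
rewrite /= ltNge => /negP; apply; elim: N => [|N IHN]; first by rewrite addn0.
by rewrite addnS (le_trans _ IHN)// ltW// r_decr.
Qed.

Theorem proposition4 (R : realType) (r : nat -> R)
    (r1 : r 1%N < 1)
    (r_decr : forall t : nat, (1 <= t)%N -> r t.+1 < r t)
    (r_cvg0 : r @ \oo --> (0 : R)) :
  exists P : probability nat R,
    on_posnat P /\
    forall t : nat, (1 <= t)%N ->
    forall (d : measure_display) (Omega : measurableType d)
      (Q : probability Omega R) (X : 'I_t -> {RV Q >-> nat}),
      iid X P -> ((r t)%:E < 'E_Q[missing_mass P X])%E.
Proof.
have r_gt0 := decreasing_cvg0_gt0 _ _ r_decr r_cvg0.
have r1_gt0 := r_gt0 1%N isT.
have [a r1a a1] : exists2 a, r 1%N < a & a < 1.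
  by exists ((r 1%N + 1) / 2); [exact: (midf_lt r1).1|exact: (midf_lt r1).2].
have a0 := lt_trans r1_gt0 r1a.
have b0 : 0 < 1 - a by rewrite subr_gt0.
have rt_lt_a t : (1 <= t)%N -> r t < a.
  case: t => // t _; elim: t => // t IHt.
  by rewrite (lt_trans _ IHt)// r_decr.
have [n n_gt0 n_large] : exists2 n : nat -> nat, (forall k, (0 < n k)%N) &
    forall k t, a ^+ k.+2 <= r t -> t%:R <= (1 - a) * (n k)%:R.
  suff /choice[n nP] : forall k, exists m, (0 < m)%N /\
      forall t, a ^+ k.+2 <= r t -> t%:R <= (1 - a) * m%:R.
    by exists n => k; have [] := nP k.
  move=> k; have [N _ rN] := cvgr_lt _ r_cvg0 _ (exprn_gt0 k.+2 a0).
  have Nb : 0 <= N%:R / (1 - a) by rewrite divr_ge0// ltW.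
  (* From index [N] on, [r] is below [a ^+ k.+2], so only [t < N] matter and any integer above
     [N / (1 - a)] will do; the successor makes it positive. *)
  exists (Num.bound (N%:R / (1 - a))).+1; split=> // t art.
  have tN : (t < N)%N.
    by rewrite ltnNge; apply/negP => /rN /=; rewrite ltNge art.
  rewrite mulrC -ler_pdivrMr// (@le_trans _ _ (N%:R / (1 - a)))//.
    by rewrite ler_pM2r ?invr_gt0// ler_nat ltnW.
  by rewrite (le_trans (ltW (archi_boundP Nb)))// ler_nat.
have w_ge0 k : 0 <= (1 - a) * a ^+ k by rewrite mulr_ge0 ?exprn_ge0 ?ltW.
have c_ge0 k : 0 <= (1 - a) * a ^+ k / (n k)%:R by rewrite divr_ge0.
pose mu := uniform_mixture R (fun k => NngNum (c_ge0 k)) n.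
have muE A : mu A = (\sum_(0 <= k <oo)
    ((1 - a) * a ^+ k / (n k)%:R)%:E * initial_counting R (n k) A)%E by [].
have n_neq0 k : (n k)%:R != 0 :> R by rewrite pnatr_eq0 -lt0n.
have mu_full A : posnat `<=` A -> mu A = 1%E.
  move=> posA; rewrite muE -[RHS](nneseries_geometric_tail R a 0 a0 a1).
  by apply: eq_eseriesr => k _; rewrite initial_counting_full// -EFinM divfK.
pose P : probability nat R :=
  HB.pack (Measure.sort mu)
    (Measure.class mu) (Measure_isProbability.Build _ _ _ mu (mu_full _ (@subsetT _ _))).
exists P; split=> [|t t1 d Omega Q X _]; first exact: (mu_full posnat (@subset_refl _ _)).
have [k art rta] : exists2 k, a ^+ k.+2 <= r t & r t < a ^+ k.+1.
  have ex : exists k, a ^+ k.+2 <= r t.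
    have a1' : `|a| < 1 by rewrite gtr0_norm.
    have [N _ /(_ N (leqnn N))/= aN] := cvgr_lt _ (cvg_expr a1') _ (r_gt0 t t1).
    exists N; rewrite (le_trans _ (ltW aN))//.
    by rewrite ler_wiXn2l ?ltW// -addn2 leq_addr.
  (* The upper bound on [r t] comes from minimality, except at index 0, where it is [r t < a]. *)
  case: (ex_minnP ex) => -[|k] art kmin.
    by exists 0%N; rewrite // expr1 rt_lt_a.
  by exists k.+1; rewrite // ltNge; apply/negP => /kmin; rewrite ltnn.
suff U_ge w : a ^+ k.+1 <= missing_mass P X w.
  rewrite unlock (@lt_le_trans _ _ (a ^+ k.+1)%:E) ?lte_fin//.
  by apply: integral_ge_cst => //; rewrite exprn_ge0 ?ltW.
rewrite /missing_mass; set A := _ `\` _.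
suff PA : ((a ^+ k.+1)%:E <= P A)%E.
  by rewrite -lee_fin fineK// fin_num_measure.
have term_ge0 j : (0 <= ((1 - a) * a ^+ j / (n j)%:R)%:E *
    initial_counting R (n j) A)%E by rewrite mule_ge0// lee_fin.
(* Components below [k] are dropped; the others have total weight [a ^+ k], and it remains to keep a
   fraction [a] of each. *)
rewrite [leRHS]muE (nneseries_split 0 k)// add0n.
rewrite -[leLHS]add0e leeD ?sume_ge0//.
rewrite exprS EFinM -(nneseries_geometric_tail R a k a0 a1).
rewrite -nneseriesZl => [|j _]; last by rewrite lee_fin.
rewrite !(eseries_cond _ _ k) lee_nneseries => [//|j _ _|j /= kj].
  by rewrite mule_ge0 ?lee_fin// ltW.
(* Since [k <= j] and [a < 1], also [a ^+ j.+2 <= r t]. The resulting bound says that [n j - t] is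
   at least [a * n j]. *)
have t_le : t%:R <= (1 - a) * (n j)%:R.
  by rewrite n_large// (le_trans _ art)// ler_wiXn2l ?ltW.
rewrite -EFinM (@le_trans _ _ (((1 - a) * a ^+ j / (n j)%:R)%:E *
    ((n j)%:R - t%:R)%:E)%E)//; last first.
  by rewrite lee_wpmul2l ?lee_fin// initial_counting_posnatD.
rewrite -EFinM lee_fin -[leRHS]mulrA [leLHS]mulrC ler_wpM2l//.
rewrite [leRHS]mulrC ler_pdivlMr ?ltr0n//.
by rewrite lerBrDr -lerBrDl (le_trans t_le)// mulrBl mul1r.
Qed.
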